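(* Let $q\geq 2$ be an integer which is not a power of $2$ and not a power of $3$ (i.e. $q\neq 2^n,3^n$ for every positive integer $n$). Then there exists an integer $a$ with $1\leq a<q$ and $\gcd(a,q)=1$ such that $K(a/q)\leq \operatorname{rad}(q)-1$.
   Context: Every rational number $a/q\in(0,1)$ has a finite simple continued fraction expansion $a/q=[a_1,\ldots,a_r]=\cfrac{1}{a_1+\cfrac{1}{a_2+\cdots+\cfrac{1}{a_r}}}$ with positive integers $a_i$, taken with $a_r\geq 2$ (when $r\geq1$ and $a/q\neq 1$). Define $K(a/q)=\max(a_1,\ldots,a_r)$. For a positive integer $n$, $\operatorname{rad}(n)$ denotes the product of the distinct prime numbers dividing $n$. *)

(* Defs.v *)
From mathcomp Require Import all_boot all_order all_algebra.
From mathcomp Require Import zify ring lra.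
Set Implicit Arguments.
Unset Strict Implicit.
Unset Printing Implicit Defensive.
Import Order.TTheory GRing.Theory Num.Theory.
Local Open Scope ring_scope.

Definition cf_value (s : seq nat) : rat := foldr (fun n x => (n%:R + x)^-1) 0 s.

(* [last 0 s >= 2] also forces [s] to be nonempty. *)
Definition is_cf (x : rat) (s : seq nat) : bool :=
  [&& all (leq 1) s, (2 <= last 0%N s)%N & cf_value s == x].

Lemma cf_exists_nat (q a : nat) :
  (0 < a < q)%N -> exists s, is_cf (a%:R / q%:R) s.
Proof.
elim/ltn_ind: q a => q IH a /andP[a0 aq].
have qE := divn_eq q a.
have aN0 : (a%:R : rat) != 0 by rewrite pnatr_eq0 -lt0n.
have d0 : (0 < q %/ a)%N by rewrite divn_gt0 // ltnW.
have [r0|r0] := posnP (q %% a)%N.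
  exists [:: (q %/ a)%N]; rewrite /is_cf /= d0 /= addr0; apply/andP; split.
    by move: qE d0; rewrite r0 addn0; case: (q %/ a)%N => [|[|n]] //; lia.
  by apply/eqP; rewrite {2}qE r0 addn0 natrM invfM mulrCA mulfV ?mulr1.
have [||s /and3P[s1 s2 /eqP s3]] := IH a _ (q %% a)%N; first exact: aq.
  by rewrite r0 ltn_mod.
exists ((q %/ a)%N :: s); rewrite /is_cf /= d0 s1 s3 /=; apply/andP; split.
  by case: s s2 {s1 s3}.
apply/eqP; have -> : (q%:R : rat) = (q %/ a)%:R * a%:R + (q %% a)%:R.
  by rewrite -natrM -natrD -qE.
by rewrite -[in RHS]invf_div mulrDl mulfK.
Qed.

Lemma cf_exists (x : rat) : 0 < x < 1 -> exists s, is_cf x s.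
Proof.
move=> /andP[x0 x1].
have n0 : 0 < numq x by rewrite numq_gt0.
have nE : numq x = `|numq x|%N :> int by rewrite gez0_abs ?ltW.
have dE : denq x = `|denq x|%N :> int by rewrite gez0_abs ?denq_ge0.
have xE : x = `|numq x|%N%:R / `|denq x|%N%:R.
  by rewrite -{1}(divq_num_den x) {1}nE {1}dE.
have lt : numq x < denq x.
  have : (numq x)%:~R / (denq x)%:~R < 1 :> rat by rewrite divq_num_den.
  by rewrite ltr_pdivrMr ?ltr0z ?denq_gt0 // mul1r ltr_int.
by rewrite xE; apply: cf_exists_nat; lia.
Qed.

(* The expansion [a_1; ...; a_r] of [x] in (0, 1); junk value [::] elsewhere. *)
Definition cf (x : rat) : seq nat :=
  if decP (@idP (0 < x < 1)) is left h then xchoose (cf_exists h) else [::].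

Definition K (x : rat) : nat := (\max_(n <- cf x) n)%N.

Definition radn (n : nat) : nat := (\prod_(p <- primes n) p)%N.

Lemma cfP (x : rat) : 0 < x < 1 -> is_cf x (cf x).
Proof. by rewrite /cf => hx; case: decP => // h; apply: xchooseP. Qed.

Lemma cf_value_itv (s : seq nat) :
  all (leq 1) s -> (2 <= last 0%N s)%N -> 0 < cf_value s < 1.
Proof.
elim: s => //= n s IH /andP[n1 s1] l2.
have n1' : (1 : rat) <= n%:R by rewrite ler1n.
suff h : 1 < n%:R + cf_value s by rewrite invr_gt0 invf_lt1 ?h ?andbT; lra.
case: s IH s1 l2 => [|m s] IH s1 l2 /=; first by rewrite addr0 ltr1n.
by have /andP[] := IH s1 l2; rewrite /=; lra.
Qed.

Lemma natrD_uniq (m n : nat) (x y : rat) :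
  0 <= x < 1 -> 0 <= y < 1 -> n%:R + x = m%:R + y -> n = m.
Proof.
move=> /andP[x0 x1] /andP[y0 y1] e.
by case: (ssrnat.ltngtP n m) => //; rewrite -(ler_nat rat) -natr1 => h; exfalso; lra.
Qed.

Lemma is_cf_uniq (x : rat) (s t : seq nat) : is_cf x s -> is_cf x t -> s = t.
Proof.
move=> /and3P[+ + /eqP<-] /and3P[+ + /eqP/esym].
have cv0 u n : all (leq 1) u -> (2 <= last n u)%N -> 0 <= cf_value u < 1.
  by case: u => [|m u] // h1 h2; have /andP[/ltW-> ->] := @cf_value_itv (m :: u) h1 h2.
elim: s t => [|n s IH] [|m t] // /andP[n1 s1] l2 /andP[m1 t1] l2' /invr_inj e.
have nm := natrD_uniq (cv0 _ _ s1 l2) (cv0 _ _ t1 l2') e.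
move: e; rewrite nm => /addrI e; congr cons.
change (cf_value s = cf_value t) in e.
case: s t s1 t1 l2 l2' e IH => [|a s] [|b t] s1 t1 l2 l2' e IH.
- by [].
- by have := @cf_value_itv (b :: t) t1 l2'; rewrite -e ltxx.
- by have := @cf_value_itv (a :: s) s1 l2; rewrite e ltxx.
- exact: IH.
Qed.

(* Main.v *)
Require Import Defs.
From mathcomp Require Import all_boot all_order all_algebra.
From mathcomp Require Import zify ring.
Set Implicit Arguments.
Unset Strict Implicit.
Local Open Scope ring_scope.

(** The folding lemma: if [a_1, ..., a_n] has denominator [q], then
    [a_1, ..., a_n, x - 1, 1, a_n - 1, a_(n-1), ..., a_1] has denominator
    [x * q ^ 2]; for [x = 1] the middle part collapses to [a_n + 1, a_n - 1].
    Every [q] is [x * q' ^ 2] with [x] squarefree, so [x <= rad q], and the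
    folding turns an expansion for [q'] into one for [q].  The strong induction
    works for an arbitrary bound [R] divisible by the primes of [q], since
    [rad q'] may be smaller than [rad q]; it also keeps both end quotients
    between [2] and [R - 2], so that the new quotients [a_n - 1] and [a_n + 1]
    are admissible.  It stops at squarefree [q] and at [q' = 2], where explicit
    expansions exist.  For [R = 6] nothing suitable exists at [q' = 4] and
    [q' = 6], so [q = x * q' ^ 2] is then treated by hand. *)

(** Expansions are unique, so any explicit one bounds [K]. *)
Lemma K_leq (x : rat) (s : seq nat) (B : nat) :
  is_cf x s -> all (geq B) s -> (K x <= B)%N.
Proof.
move=> cfs /allP sB; have /and3P[s1 s2 /eqP sE] := cfs.
have /cfP cfx : 0 < x < 1 by rewrite -sE cf_value_itv.
by rewrite /K (is_cf_uniq cfx cfs); apply/bigmax_leqP_seq => n /sB.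
Qed.

(** * Denominators as continuants *)

Local Open Scope nat_scope.
Implicit Types (n q R x d : nat) (s t u : seq nat) (v w : nat * nat).

(** A pair [v] encodes the fraction [v.2 / v.1]; the step sends [y] to [1 / (n + y)], starting from
    [(1, 0)], that is [0]. *)
Definition cf_step n v : nat * nat := (n * v.1 + v.2, v.1).

Definition cf_act s v : nat * nat := foldr cf_step v s.

Definition cf_den s : nat := (cf_act s (1, 0)).1.
Definition cf_num s : nat := (cf_act s (1, 0)).2.

Definition dot v w : nat := v.1 * w.1 + v.2 * w.2.

(* [cf_step n] is given by the symmetric matrix [[n, 1], [1, 0]]. *)
Lemma dot_cf_act s v w : dot (cf_act s v) w = dot v (cf_act (rev s) w).
Proof.
elim: s w => //= n s IH w; rewrite rev_cons /cf_act foldr_rcons -IH.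
by rewrite /dot /cf_step /=; ring.
Qed.

Lemma cf_act_cat s t v : cf_act (s ++ t) v = cf_act s (cf_act t v).
Proof. exact: foldr_cat. Qed.

Lemma cf_den_cat s t :
  cf_den (s ++ t) = dot (cf_act (rev s) (1, 0)) (cf_act t (1, 0)).
Proof. by rewrite dot_cf_act revK -cf_act_cat /dot /cf_den mul1n mul0n addn0. Qed.

Lemma cf_den_gt0 s : all (leq 1) s -> 0 < cf_den s.
Proof.
by elim: s => //= n s IH /andP[n1 /IH]; rewrite /cf_den /= addn_gt0 muln_gt0 n1 => ->.
Qed.

Lemma coprime_cf_num_den s : coprime (cf_num s) (cf_den s).
Proof.
elim: s => //= n s; rewrite /cf_num /cf_den /= => IH.
by rewrite /coprime gcdnMDl gcdnC.
Qed.

Definition fold_mid x d : seq nat :=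
  if x <= 1 then [:: d.+1; d.-1] else [:: d; x.-1; 1; d.-1].

(** With [(a, b) = cf_act (rev u) (1, 0)], splitting after [u] makes the left side a quadratic form
    in [a] and [b], equal to [x * (a * d + b) ^ 2]. *)
Lemma cf_den_fold u d x : 0 < x -> 0 < d ->
  cf_den (u ++ fold_mid x d ++ rev u) = x * cf_den (rcons u d) ^ 2.
Proof.
case: d => // d; rewrite -cats1 !cf_den_cat cf_act_cat.
case: (cf_act (rev u) _) => a b; rewrite /dot /fold_mid.
by case: x => [|[|x]] //= _ _; ring.
Qed.

Lemma cf_value_num_den s : all (leq 1) s ->
  cf_value s = ((cf_num s)%:R / (cf_den s)%:R)%R.
Proof.
elim: s => [|n s IH] /= => [_|/andP[n1 s1]]; first by rewrite GRing.mul0r.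
have d0 : ((cf_den s)%:R != 0 :> rat)%R.
  by rewrite Num.Theory.pnatr_eq0 -lt0n cf_den_gt0.
rewrite IH // -[RHS]GRing.invf_div; congr (_^-1)%R.
by rewrite /cf_den /= GRing.natrD GRing.natrM GRing.mulrDl GRing.mulfK.
Qed.

Lemma is_cf_num_den s : all (leq 1) s -> 1 < last 0 s ->
  is_cf ((cf_num s)%:R / (cf_den s)%:R)%R s.
Proof. by move=> s1 s2; rewrite /is_cf s1 s2 cf_value_num_den ?eqxx. Qed.

Definition inner R n := (1 < n) && (n.+1 < R).

(* Folding [[:: d]] gives end quotients [d - 1] and [d] or [d + 1], whence the
   stricter bounds on a single quotient. *)
Definition good R q := exists s,
  [/\ cf_den s = q, all (fun n => 0 < n < R) s,
      inner R (head 0 s), inner R (last 0 s)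
    & (size s == 1) ==> (2 < head 0 s) && ((head 0 s).+2 < R)].

Lemma good_fold R q x : good R q -> 0 < x <= R -> good R (x * q ^ 2).
Proof.
case=> s [<- sR hs ls s2] /andP[x0 xR].
case/lastP: s sR hs ls s2 => [|u d] // sR hs; rewrite last_rcons => ld ud2.
have dR : 1 < d /\ d.+1 < R by move/andP: ld.
exists (u ++ fold_mid x d ++ rev u).
have midR : all (fun n => 0 < n < R) (fold_mid x d).
  by rewrite /fold_mid; case: leqP => x1 /=; lia.
rewrite cf_den_fold //; last by case: dR => /ltnW.
case: u sR hs ud2 => [|c u] /=.
  rewrite cats0 => _ _ /andP[d2 dR2].
  by split=> //; rewrite /fold_mid /inner; case: (leqP x 1) => x1 //=; lia.
(* Both ends of the folded expansion are now the first quotient [c]. *)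
rewrite all_rcons => /andP[cR /andP[_ uR]] hc _.
split=> //.
- by rewrite !all_cat all_rev /= cR uR midR.
- by rewrite rev_cons -!rcons_cat last_rcons.
- by rewrite !size_cat size_rev /= addnS addnS.
Qed.

(** * Square factors and the induction *)

Definition squarefree x := forall p, prime p -> ~~ (p ^ 2 %| x).

Lemma square_decomposition q : 0 < q ->
  exists x m, [/\ 0 < x, 0 < m, q = x * m ^ 2 & squarefree x].
Proof.
elim/ltn_ind: q => q IH q0.
have [/allP sq|] := boolP (all (fun p => ~~ (p ^ 2 %| q)) (primes q)).
  exists q, 1; split; rewrite ?muln1 // => p pp.
  have [pq|] := boolP (p %| q); first by apply: sq; rewrite mem_primes pp q0.
  by apply: contra; apply: dvdn_trans; apply: dvdn_exp.
case/allPn=> p; rewrite mem_primes negbK => /and3P[pp _ _] /dvdnP[k qE].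
have p1 := prime_gt1 pp.
have k0 : 0 < k by case: k qE q0 => [->|].
case: (IH k) => // [|x [m [x0 m0 kE sx]]]; first by rewrite qE ltn_Pmulr // -(exp1n 2) ltn_sqr.
exists x, (m * p); split=> //; first by rewrite muln_gt0 m0 ltnW.
by rewrite qE kE expnMn mulnA.
Qed.

Lemma squarefree_dvdn x R : 0 < x -> squarefree x ->
  (forall p, prime p -> p %| x -> p %| R) -> x %| R.
Proof.
move=> x0 sx xR; apply/dvdn_partP => // p.
rewrite mem_primes => /and3P[pp _ px]; rewrite p_part.
have := sx p pp; rewrite pfactor_dvdn // -ltnNge ltnS => le1.
by apply: dvdn_trans (xR p pp px); rewrite -[X in _ %| X]expn1 dvdn_exp2l.
Qed.

Lemma good_squarefree R q : 2 < q <= R -> squarefree q ->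
  (q = 3 -> 5 < R) -> (q = 6 -> 8 < R) -> good R q.
Proof.
move=> /andP[q2 qR] /(_ 2 isT); rewrite -[2 ^ 2]/4 => q4 q3 q6.
have [qE|qN3] := eqVneq q 3.
  by have := q3 qE; exists [:: 3]; split=> //=; rewrite /inner; lia.
have [qE|qN6] := eqVneq q 6.
  by have := q6 qE; exists [:: 6]; split=> //=; rewrite /inner; lia.
have [->|q10] := eqVneq q 10.
  by exists [:: 3; 3]; split=> //=; rewrite /inner; lia.
(* Since [4] does not divide [q], an even [q] is [8 * k + 6] or [8 * k + 2]; the exceptions [6] and
   [10] would give a quotient [0], and [3] an end quotient [1]. *)
have [qodd|qeven] := boolP (odd q).
  by exists [:: q./2; 2]; split=> //=; rewrite /inner /cf_den /=; lia.
have [q8|q8] := eqVneq (q %% 8) 6.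
  by exists [:: 2; q %/ 8; 4]; split=> //=; rewrite /inner /cf_den /=; lia.
by exists [:: 2; (q %/ 8).-1; 1; 3]; split=> //=; rewrite /inner /cf_den /=; lia.
Qed.

Lemma good_of_primes R q : 4 < R -> 2 < q ->
  (forall p, prime p -> p %| q -> p %| R) -> (R = 6 -> q <> 4 /\ q <> 6) -> good R q.
Proof.
move=> R4; elim/ltn_ind: q => q IH q2 qR R6.
have [//|x [m [x0 m0 qE sx]]] := @square_decomposition q; first exact: ltnW (ltnW q2).
have xR : x %| R.
  by apply: squarefree_dvdn => // p pp px; apply: qR => //; rewrite qE dvdn_mulr.
have mR p : prime p -> p %| m -> p %| R.
  by move=> pp pm; apply: qR => //; rewrite qE dvdn_mull // dvdn_exp.
have xleR : x <= R by apply: dvdn_leq => //; lia.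
have [m1|mN1] := eqVneq m 1.
  have xq : x = q by rewrite qE m1 muln1.
  rewrite xq in xleR xR sx; apply: good_squarefree => //; first by rewrite q2.
    (* Here [q] divides [R]: a multiple of [3] above [4] exceeds [5], and a multiple of [6] other
       than [6] exceeds [8]. *)
    by move=> q3; case/dvdnP: xR => k; lia.
  by move=> q6; case/dvdnP: xR => k; lia.
have [m2|mN2] := eqVneq m 2.
  have /dvdnP[k Rk] : 2 %| R by apply: mR; rewrite ?m2.
  have [x1|xN1] := eqVneq x 1.
    by exists [:: 4]; split=> //=; rewrite ?qE ?m2 ?x1 /inner //; lia.
  by exists [:: 2; x.-1; 2]; split=> //=; rewrite ?qE ?m2 /inner /cf_den /=; lia.
have [R6E|RN6] := eqVneq R 6.
  have [m4|mN4] := eqVneq m 4.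
    rewrite R6E in xleR *; have [x1|xN1] := eqVneq x 1.
      by exists [:: 2; 3; 2]; rewrite qE m4 x1.
    (* This folds [[:: 4]]; the ends [4] and [3] are allowed, whereas [x = 1] would give
       [[:: 5; 3]], with [5] too large. *)
    exists [:: 4; x.-1; 1; 3]; rewrite qE m4.
    by split=> //=; rewrite /inner /cf_den /=; lia.
  have [m6|mN6] := eqVneq m 6.
    have : x \in divisors 6 by rewrite -dvdn_divisors // -R6E.
    rewrite R6E qE m6 !inE => /or4P[] /eqP->.
    - by exists [:: 3; 3; 1; 2].
    - by exists [:: 4; 4; 4].
    - by exists [:: 4; 1; 2; 3; 2].
    - by exists [:: 4; 2; 2; 4; 2].
  rewrite qE; apply: good_fold; last by rewrite x0.
  by apply: IH => //; [nia | lia | move=> _; split; apply/eqP].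
rewrite qE; apply: good_fold; last by rewrite x0.
by apply: IH => //; [nia | lia | move/eqP; rewrite (negPf RN6)].
Qed.

(** * The radical and the conclusion *)

Lemma radn_gt0 q : 0 < radn q.
Proof.
by rewrite /radn big_seq prodn_cond_gt0 // => p; rewrite mem_primes => /andP[/prime_gt0].
Qed.

Lemma prime_dvdn_radn p q : 0 < q -> prime p -> p %| q -> p %| radn q.
Proof.
move=> q0 pp pq; have pin : p \in primes q by rewrite mem_primes pp q0.
by rewrite /radn (big_rem p) //= dvdn_mulr.
Qed.

(** Some prime factor is not [2] and some is not [3]; a radical at most [4] would force these to be
    [3] and [2], hence be a multiple of [6]. *)
Lemma radn_gt4 q : 1 < q -> (forall n, 0 < n -> q <> 2 ^ n) ->
  (forall n, 0 < n -> q <> 3 ^ n) -> 4 < radn q.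
Proof.
move=> q1 h2 h3; rewrite ltnNge; apply/negP => le4.
have q0 := ltnW q1.
have Npow b : prime b -> (forall n, 0 < n -> q <> b ^ n) ->
    exists p, [/\ prime p, p %| q & p != b].
  move=> pb hb; have [/allP allb|/allPn[p]] := boolP (all (pred1 b) (primes q)).
    have /p_natP[n qE] : b.-nat q.
      by rewrite /pnat q0; apply/allP => p /allb.
    by case: n qE => [qE|n /hb []] //; rewrite qE in q1.
  by rewrite mem_primes => /and3P[pp _ pq] pb2; exists p.
have le_rad p : prime p -> p %| q -> p %| radn q /\ p <= radn q.
  by move=> pp pq; split; [|apply: dvdn_leq; first exact: radn_gt0];
     apply: prime_dvdn_radn.
have [p [pp pq p2]] := Npow 2 isT h2; have [r [pr rq r3]] := Npow 3 isT h3.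
have [pd ple] := le_rad p pp pq; have [rd rle] := le_rad r pr rq.
have pE : p = 3 by move: pp p2 (leq_trans ple le4); case: p {pq pd ple} => [|[|[|[|[|]]]]].
have rE : r = 2 by move: pr r3 (leq_trans rle le4); case: r {rq rd rle} => [|[|[|[|[|]]]]].
by rewrite pE rE in pd rd *; lia.
Qed.

Lemma good_K R q : good R q ->
  exists a, [/\ 1 <= a < q, coprime a q & K (a%:R / q%:R)%R <= R - 1].
Proof.
case=> s [<- sR _ /andP[ls _] _].
have s1 : all (leq 1) s by apply: sub_all sR => n /andP[].
have cfs := is_cf_num_den s1 ls.
exists (cf_num s); split; last first.
- apply: K_leq cfs _.
  by apply: sub_all sR => n; rewrite /=; lia.
- exact: coprime_cf_num_den.
have := cf_value_itv s1 ls; rewrite cf_value_num_den //.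
have d0 : (0 < (cf_den s)%:R :> rat)%R by rewrite Num.Theory.ltr0n cf_den_gt0.
rewrite Num.Theory.ltr_pdivrMr // GRing.mul1r Num.Theory.ltr_nat.
by rewrite Num.Theory.pmulr_lgt0 ?Num.Theory.invr_gt0 // Num.Theory.ltr0n.
Qed.

Local Open Scope ring_scope.

Theorem theorem2 (q : nat) (hq : (2 <= q)%N)
    (h2 : forall n : nat, (0 < n)%N -> q <> (2 ^ n)%N)
    (h3 : forall n : nat, (0 < n)%N -> q <> (3 ^ n)%N) :
  exists a : nat,
    [/\ (1 <= a < q)%N, coprime a q & (K (a%:R / q%:R) <= radn q - 1)%N].
Proof.
have R4 := radn_gt4 hq h2 h3.
(* The only candidates are [1/6 = [6]] and [5/6 = [1, 5]]; the latter meets the bound [5] but its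
   ends violate [inner]. *)
have [->|q6] := eqVneq q 6%N.
  exists 5%N; split=> //.
  have -> : radn 6 = 6%N by rewrite /radn /= !big_cons big_nil.
  exact: (K_leq (s := [:: 1; 5]%N)).
apply: good_K; apply: good_of_primes => // [|p pp pq|_].
- by have := h2 1%N isT; rewrite expn1; lia.
- by apply: prime_dvdn_radn => //; apply: ltnW.
- by split; [apply: (h2 2%N) | apply/eqP].
Qed.
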